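(* Let $\mathbf{G}$ be a finite abelian group with $N=|\mathbf{G}|$, let $A\subseteq\mathbf{G}$ with $|A|=\delta N$, let $l>1$ be an integer, and let $|A-A|=K|A|$. Suppose that $|A|\geqslant K^{8(l-1)}$ and $|A|>4l^4$. Then $$M^{2(l-1)}(A)\,\rho_l(A)\geqslant \frac{|A|^{2l-1}}{K^{l-1}}\left(1-\frac{2l^2}{\sqrt{|A|}}\right)\left(1-\frac{12(l-1)\log^2K}{\log|A|}-K^2\delta\right)^{l-1}.$$
   Context: For $f:\mathbf{G}\to\mathbb{C}$ and $\xi$ in the dual group, $\widehat f(\xi)=\sum_{g} f(g)\overline{\xi(g)}$; a set $A$ is identified with its indicator function. $M(A)=\max_{\xi\neq0}|\widehat{A}(\xi)|$, the maximum over nontrivial characters. For an integer $l>1$, $\rho_l(A)=\max_{|X|=l}|(A+x_1)\cap\cdots\cap(A+x_l)|$, the maximum over all sets $X=\{x_1,\dots,x_l\}\subseteq\mathbf{G}$ of cardinality exactly $l$. $A-A=\{a-b:a,b\in A\}$. Logarithms are natural.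
   Formalization: For odd l the formal theorem also assumes that 1 − 12(l−1)log²K/log|A| − K²δ is nonnegative; without this the claim is false (l = 3, A the quadratic residues mod a large prime, where the negative bracket is squared). *)

(* Defs.v *)
From mathcomp Require Import all_boot all_order all_algebra.
From mathcomp Require Import complex.
From mathcomp Require Import all_classical all_reals all_analysis.

Set Implicit Arguments.
Unset Strict Implicit.
Unset Printing Implicit Defensive.

Import Order.TTheory GRing.Theory Num.Theory.

Local Open Scope ring_scope.
Local Open Scope complex_scope.

Definition is_character (R : realType) (G : finZmodType) (xi : G -> R[i]) : Prop :=
  (forall x y : G, xi (x + y) = xi x * xi y) /\ (forall x : G, `|xi x| = 1).

Definition fourier (R : realType) (G : finZmodType) (f xi : G -> R[i]) : R[i] :=
  \sum_(g : G) f g * (xi g)^*%C.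

Definition indicator (R : realType) (G : finZmodType) (A : {set G}) : G -> R[i] :=
  fun g => (g \in A)%:R.

(* The supremum is that of a finite set of reals, so it is a maximum as soon as
   [G] is nontrivial.  The norm on [R[i]] takes its values in [R[i]], hence the
   projection [complex.Re]. *)
Definition max_fourier (R : realType) (G : finZmodType) (A : {set G}) : R :=
  sup [set r : R | exists2 xi : G -> R[i],
         is_character xi /\ (exists x : G, xi x <> 1)
         & r = complex.Re `|fourier (indicator R A) xi| ]%classic.

Definition translate (G : finZmodType) (A : {set G}) (x : G) : {set G} :=
  [set a + x | a in A]%SET.

Definition diffset (G : finZmodType) (A : {set G}) : {set G} :=
  [set a - b | a in A, b in A]%SET.

(* For [l = 0] the empty intersection would be the whole group, and for
   [#|G| < l] the empty maximum is [0]. *)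
Definition rho (G : finZmodType) (l : nat) (A : {set G}) : nat :=
  \max_(X : {set G} | #|X| == l) #|\bigcap_(x in X) translate A x|%SET.

(* Main.v *)
Require Import Defs.
From mathcomp Require Import all_boot all_order all_algebra.
From mathcomp Require Import complex.
From mathcomp Require Import all_classical all_reals all_analysis.
From mathcomp Require Import zify ring lra.

(* Write n = |A|, and among the subsets B of A with |B| >= t := K sqrt(n) / 2 pick
   one that minimizes |A - B|; put |A - B| = K' n, so that 1 <= K' <= K.

   Counting the pairs (d, Y) with Y a subset of B of cardinality l and d + Y
   contained in A, convexity gives rho_l(A) >= n / K'^(l-1), up to the factor
   1 - 2 l^2 / sqrt(n).

   Let S = A - A and A_x = {c in A | c + x in A}.  Since A - A_x is contained,
   up to sign, in the set of the s in S with s + x in S, minimality of B yields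
   |S meet (S - x)| >= K' n as soon as |A_x| >= t, which is the case for almost
   all pairs of A x A of difference x.  Hence sum_x |A_x| |S meet (S - x)| is
   nearly K' n^3, while by Parseval it is at most n^2 |S|^2 / N + M(A)^2 |S|, so
   that M(A)^2 is at least about (K' / K) n^2.  The powers of K' cancel in
   M(A)^(2(l-1)) rho_l(A). *)

Set Implicit Arguments.
Unset Strict Implicit.

Import Order.TTheory GRing.Theory Num.Theory.
Local Open Scope ring_scope.

(** * Simultaneous diagonalization of the translations of [G] *)

Section Translations.
Local Open Scope sesquilinear_scope.
Variables (C : numClosedFieldType) (G : finZmodType).
Local Notation N := #|{: G}|.
Local Notation e := (@enum_val G (mem G)).

Definition translation_mx (g : G) : 'M[C]_N :=
  \matrix_(i, j) (e j == e i + g)%:R.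

Lemma mul_translation_mx m (P : 'M[C]_(m, N)) g i x :
  (P *m translation_mx g) i (enum_rank x) = P i (enum_rank (x - g)).
Proof.
rewrite mxE (bigD1 (enum_rank (x - g))) //= mxE !enum_rankK subrK eqxx mulr1.
rewrite big1 ?addr0 // => k kx; rewrite mxE enum_rankK.
case: eqP => [xE|]; last by rewrite mulr0.
by move: kx; rewrite xE addrK enum_valK eqxx.
Qed.

Lemma translation_mxM g h :
  translation_mx g *m translation_mx h = translation_mx (g + h).
Proof.
apply/matrixP => i j; rewrite -[j]enum_valK mul_translation_mx !mxE !enum_rankK.
by rewrite subr_eq addrA.
Qed.

Lemma translation_mx_adj g : (translation_mx g)^t* = translation_mx (- g).
Proof.
apply/matrixP => i j; rewrite !mxE conjC_nat; congr (nat_of_bool _)%:R.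
by rewrite [RHS]eq_sym subr_eq.
Qed.

(* A unitary matrix which makes all translations triangular makes them diagonal,
   because the set of translations is closed under taking adjoints. *)
Lemma translation_mx_codiag : exists2 P : 'M[C]_N, P \is unitarymx &
  forall g, exists d : 'I_N -> C, forall i x,
    P i (enum_rank (x - g)) = d i * P i (enum_rank x).
Proof.
have [|P Pu /allP Ptrig] :=
    @cotrigonalization C N [seq translation_mx g | g <- enum G].
  move=> _ _ /mapP[g _ ->] /mapP[h _ ->].
  by rewrite /comm_mx !translation_mxM addrC.
exists P => // g; pose D h := P *m translation_mx h *m P^t*.
have Dtrig h : is_trig_mx (D h).
  rewrite /D -conjymx //; apply: Ptrig.
  by apply/mapP; exists h; rewrite ?mem_enum.
have DN h : (D h)^t* = D (- h).
  rewrite /D !trmx_mul !map_mxM /= -translation_mx_adj trmxCK mulmxA.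
  by [].
exists (fun i => D g i i) => i x.
have PT : P *m translation_mx g = D g *m P by rewrite /D mulmxKtV.
rewrite -mul_translation_mx PT mxE (bigD1 i) //= big1 ?addr0 // => k ki.
suff -> : D g i k = 0 by rewrite mul0r.
have [ik|ki'|/val_inj ik] := ltngtP i k; last by rewrite ik eqxx in ki.
  exact: (is_trig_mxP (Dtrig g)).
have := is_trig_mxP (Dtrig (- g)) _ _ ki'.
by rewrite -DN !mxE => /eqP; rewrite conjC_eq0 => /eqP.
Qed.

End Translations.

(** * Characters as common eigenvectors, and Parseval *)

Section CharacterBasis.
Local Open Scope sesquilinear_scope.
Variables (C : numClosedFieldType) (G : finZmodType).
Local Notation N := #|{: G}|.

Lemma dotmx_rows m p n (A : 'M[C]_(m, n)) (B : 'M[C]_(p, n)) i j :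
  (A *m B^t*) i j = \sum_k A i k * (B j k)^*.
Proof. by rewrite mxE; apply: eq_bigr => k _; rewrite !mxE. Qed.

Lemma sum_enum_rank (V : nmodType) (F : 'I_N -> V) :
  \sum_k F k = \sum_(x : G) F (enum_rank x).
Proof.
by rewrite (reindex enum_rank) //; apply: onW_bij; apply: enum_rank_bij.
Qed.

(** A common eigenvector [v] of the translations satisfies [v (x + y) * v 0 = v x * v y], so
    dividing it by [v 0] gives a character. The rows of a unitary matrix of eigenvectors thus yield
    [N] distinct characters, and Parseval is the invariance of the norm under that matrix. *)
Lemma character_basis : exists xi : 'I_N -> G -> C,
  [/\ forall i x y, xi i (x + y) = xi i x * xi i y,
      forall i x, `|xi i x| = 1,
      forall i j, xi i =1 xi j -> i = j
    & forall f : G -> C, \sum_i `|\sum_g f g * (xi i g)^*| ^+ 2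
                         = N%:R * \sum_g `|f g| ^+ 2].
Proof.
have [P Pu Pd] := @translation_mx_codiag C G.
pose v i x := P i (enum_rank x); pose xi i x := v i x / v i 0.
have PPt i j : \sum_x v i x * (v j x)^* = (i == j)%:R.
  by rewrite -(sum_enum_rank (fun k => P i k * (P j k)^*)) -dotmx_rows
             (unitarymxP _) // mxE.
have PPt1 i : \sum_x v i x * (v i x)^* = 1 by rewrite PPt eqxx.
have vD i x y : v i (x + y) * v i 0 = v i x * v i y.
  have [d dP] := Pd (- y); have /= := dP i x; have /= := dP i 0.
  by rewrite opprK add0r /v => -> ->; rewrite mulrAC mulrC.
(* If [v i 0] vanished, [vD] at [y = x] would give [v i x ^+ 2 = 0] for every [x], against the unit
   norm of the row. *)
have v0 i : v i 0 != 0.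
  apply/eqP => vi0; have := PPt1 i; rewrite big1 => [/eqP|x _].
    by rewrite eq_sym oner_eq0.
  have := vD i x x; rewrite vi0 mulr0 => /esym/eqP.
  by rewrite mulf_eq0 orbb => /eqP ->; rewrite mul0r.
have vE i x : v i x = v i 0 * xi i x by rewrite /xi mulrC divfK.
have xiD i x y : xi i (x + y) = xi i x * xi i y.
  by apply: (mulfI (v0 i)); apply: (mulIf (v0 i)); rewrite -vE vD (vE i x) (vE i y); ring.
(* Translation by [y] permutes the entries of the row, yet multiplies its squared norm by the
   squared modulus of [xi i y]. *)
have nxi i y : `|xi i y| = 1.
  have sum1 : \sum_x `|v i x| ^+ 2 = 1.
    by rewrite -[RHS](PPt1 i); apply: eq_bigr => x _; rewrite normCK.
  apply/eqP; rewrite -sqrp_eq1 // -[X in _ == X]sum1.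
  rewrite [X in _ == X](reindex_inj (addIr y)) /= -[X in X == _]mulr1 -sum1 mulr_sumr.
  apply/eqP/eq_bigr => x _; rewrite (vE i x) (vE i (x + y)) xiD !normrM; ring.
have nv0 i : `|v i 0| ^+ 2 * N%:R = 1.
  rewrite -[RHS](PPt1 i); rewrite mulr_natr -sumr_const.
  by apply: eq_bigr => x _; rewrite -normCK (vE i x) normrM nxi mulr1.
exists xi; split=> //.
(* Rows with equal characters would be nonzero multiples of each other, hence not orthogonal. *)
- move=> i j ij; apply/eqP; apply: contraT => /negPf nij.
  have : \sum_x v i x * (v j x)^* == 0 by rewrite PPt nij.
  rewrite (eq_bigr (fun=> v i 0 * (v j 0)^*)) => [|x _]; last first.
    rewrite (vE i x) (vE j x) ij rmorphM /=.
    have := nxi j x; move/(congr1 (fun z => z ^+ 2)); rewrite normCK expr1n => n1.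
    by rewrite mulrACA n1 mulr1.
  have N0 : N%:R != 0 :> C.
    by apply/eqP => N0; have /eqP := nv0 i; rewrite N0 mulr0 eq_sym oner_eq0.
  rewrite sumr_const -mulr_natr !mulf_eq0 conjC_eq0.
  by rewrite (negPf (v0 i)) (negPf (v0 j)) (negPf N0).
(* Entry [i] of [Fh] is the Fourier coefficient at [xi i] times the conjugate of [v i 0], whose
   squared modulus is [1 / N] by [nv0]. *)
- move=> f; pose F := \row_k f (enum_val k) : 'rV[C]_N.
  pose Fh := F *m P^t*; have FP : Fh *m Fh^t* = F *m F^t*.
    rewrite /Fh trmx_mul map_mxM /= trmxCK mulmxA -(mulmxA F).
    by rewrite -invmx_unitary // mulVmx ?mulmx1 // unitarymx_unit.
  have := congr1 (fun A : 'M[C]_1 => A 0 0) FP; rewrite !dotmx_rows.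
  under eq_bigr do rewrite -normCK.
  under [RHS]eq_bigr do rewrite -normCK.
  rewrite [in RHS]sum_enum_rank.
  under [RHS]eq_bigr do rewrite mxE enum_rankK.
  move=> <-; rewrite mulr_sumr; apply: eq_bigr => i _.
  rewrite /Fh dotmx_rows sum_enum_rank.
  under [X in _ = _ * `|X| ^+ 2]eq_bigr do
    rewrite mxE enum_rankK -/(v i _) vE rmorphM mulrCA.
  by rewrite -mulr_sumr normrM norm_conjC exprMn mulrA [_%:R * _]mulrC nv0 mul1r.
Qed.

End CharacterBasis.

(** * The Fourier bound on correlations *)

Section Energy.
Variable G : finZmodType.
Implicit Types A S : {set G}.
Local Notation N := #|{: G}|.

Definition overlap A (x : G) : {set G} := [set c in A | c + x \in A]%SET.

Section Correlation.
Variable R : comPzRingType.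
Local Notation "''1_' A" := (fun g => (g \in A)%:R : R) (at level 8, A at level 2).

Lemma sum_indicator A : \sum_g '1_A g = #|A|%:R.
Proof. by rewrite -natr_sum -big_mkcond sum1_card. Qed.

Lemma card_overlap A x : #|overlap A x|%:R = \sum_g '1_A g * '1_A (g + x).
Proof.
rewrite -sum_indicator; apply: eq_bigr => g _.
by rewrite inE -natrM mulnb.
Qed.

(** Both sides count the quadruples with [a' - a = s' - s], the right one in the form
    [a - s = a' - s']. The sum of squares is then open to Parseval. *)
Lemma sum_overlapM A S :
  \sum_x #|overlap A x|%:R * #|overlap S x|%:R
  = \sum_y (\sum_s '1_S s * '1_A (s + y)) ^+ 2.
Proof.
under eq_bigr do rewrite !card_overlap mulr_sumr.
under [RHS]eq_bigr do rewrite expr2 mulr_sumr.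
rewrite exchange_big [RHS]exchange_big /=; apply: eq_bigr => s _.
under eq_bigr do rewrite mulr_suml.
under [RHS]eq_bigr do rewrite mulr_suml.
under eq_bigr do rewrite (reindex_inj (addrI s)) /=.
under [RHS]eq_bigr do rewrite (reindex_inj (addrI s)) /=.
rewrite exchange_big /=; apply: eq_bigr => y _; apply: eq_bigr => x _.
rewrite (addrAC s y x); ring.
Qed.

End Correlation.

Lemma norm_fourier_le (C : numClosedFieldType) A (xi : G -> C) :
  (forall x, `|xi x| = 1) -> `|\sum_g (g \in A)%:R * (xi g)^*| <= #|A|%:R.
Proof.
move=> nxi; rewrite -(sum_indicator C); apply: le_trans (ler_norm_sum _ _ _) _.
by apply: ler_sum => g _; rewrite normrM norm_conjC nxi mulr1 normr_nat.
Qed.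

(** The cross-correlation [h] has transform [hat A] times the conjugate of [hat S], so Parseval
    turns the left side into a sum over characters. The trivial one gives the first term; the others
    are bounded by [M ^+ 2] and Parseval for [S]. *)
Lemma fourier_energy_bound (C : numClosedFieldType) A S (M : C) :
  M \is Num.real ->
  (forall xi : G -> C, (forall x y, xi (x + y) = xi x * xi y) ->
     (forall x, `|xi x| = 1) -> (exists x, xi x <> 1) ->
     `|\sum_g (g \in A)%:R * (xi g)^*| <= M) ->
  N%:R * (\sum_x #|overlap A x|%:R * #|overlap S x|%:R)
  <= #|A|%:R ^+ 2 * #|S|%:R ^+ 2 + M ^+ 2 * (N%:R * #|S|%:R).
Proof.
move=> Mreal Mbound; have [xi [xiD nxi xi_inj parseval]] := character_basis C G.
pose hat (B : {set G}) i := \sum_g (g \in B)%:R * (xi i g)^* : C.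
pose h y := \sum_s (s \in S)%:R * (s + y \in A)%:R : C.
have hat_h i : \sum_y h y * (xi i y)^* = hat A i * (hat S i)^*.
  rewrite rmorph_sum mulr_sumr /=.
  under eq_bigr do rewrite mulr_suml.
  rewrite exchange_big; apply: eq_bigr => s _ /=.
  rewrite rmorphM /= conjCK conjC_nat mulrCA.
  under eq_bigr do rewrite -mulrA.
  rewrite -mulr_sumr mulr_suml; congr (_ * _).
  rewrite [RHS](reindex_inj (addrI s)) /=; apply: eq_bigr => y _.
  by rewrite xiD rmorphM /= -mulrA; congr (_ * _); rewrite mulrAC -normCKC nxi expr1n mul1r.
have energyE : N%:R * (\sum_x #|overlap A x|%:R * #|overlap S x|%:R)
    = \sum_i `|hat A i| ^+ 2 * `|hat S i| ^+ 2.
  rewrite sum_overlapM -/(h _).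
  have h_ge0 y : 0 <= h y by apply: sumr_ge0 => s _; rewrite mulr_ge0 ?ler0n.
  under eq_bigr do rewrite -/(h _) -(ger0_norm (h_ge0 _)).
  rewrite -parseval; apply: eq_bigr => i _.
  by rewrite hat_h normrM norm_conjC exprMn.
have hatS : \sum_i `|hat S i| ^+ 2 = N%:R * #|S|%:R.
  rewrite parseval -(sum_indicator C); congr (_ * _); apply: eq_bigr => g _.
  by case: (g \in S); rewrite ?normr1 ?normr0 ?expr1n ?expr0n.
have hat_le B i : `|hat B i| <= #|B|%:R by apply: norm_fourier_le.
rewrite energyE -hatS mulr_sumr.
have nontrivial i : ~~ [forall x, xi i x == 1] -> `|hat A i| <= M.
  rewrite negb_forall => /existsP[x /eqP xi1].
  by apply: Mbound => //; exists x.
have le_nontrivial i : ~~ [forall x, xi i x == 1] ->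
    `|hat A i| ^+ 2 * `|hat S i| ^+ 2 <= M ^+ 2 * `|hat S i| ^+ 2.
  by move=> xi1; rewrite ler_wpM2r ?exprn_ge0 // lerXn2r ?nnegrE ?nontrivial //;
     apply: le_trans (nontrivial _ xi1).
(* Injectivity leaves at most one trivial character in the family; if there is none, every term is
   bounded through [M]. *)
case: (pickP (fun i => [forall x, xi i x == 1])) => [i0 /forallP xi0|no1].
  rewrite (bigD1 i0) //= lerD //.
    by rewrite ler_pM ?exprn_ge0 // lerXn2r ?nnegrE.
  (* If [i0] is the only index, nothing forces [M] to be nonnegative; [0 <= M ^+ 2] comes from [M]
     being real. *)
  rewrite [leRHS](bigD1 i0) //= ler_wpDl //.
    by apply: mulr_ge0; [apply: real_exprn_even_ge0 | apply: exprn_ge0].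
  apply: ler_sum => i ii0; apply: le_nontrivial; apply: contra ii0 => /forallP xi1.
  by apply/eqP/xi_inj => x; rewrite (eqP (xi0 x)) (eqP (xi1 x)).
rewrite ler_wpDl ?mulr_ge0 ?exprn_ge0 //.
by apply: ler_sum => i _; apply: le_nontrivial; rewrite no1.
Qed.

End Energy.

(** * Transfer to the real number [max_fourier] *)

Section MaxFourier.
Local Open Scope complex_scope.
Variables (R : realType) (G : finZmodType).
Implicit Types A S : {set G}.

Lemma fourier_le_max A (xi : G -> R[i]) :
  is_character xi -> (exists x, xi x <> 1) ->
  `|fourier (indicator R A) xi| <= (max_fourier R A)%:C.
Proof.
move=> xi_char xi1; rewrite -[leLHS]RRe_real ?normr_real // lecR.
(* The bound [#|A|] makes [sup] a genuine upper bound instead of a default value. *)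
apply: ub_le_sup; last by exists xi.
exists #|A|%:R => _ [zeta [[_ nzeta] _] ->].
rewrite -lecR RRe_real ?normr_real // rmorph_nat.
exact: norm_fourier_le.
Qed.

Lemma sum_overlap_le A S :
  \sum_x #|overlap A x|%:R * #|overlap S x|%:R
  <= #|A|%:R ^+ 2 * #|S|%:R ^+ 2 / #|G|%:R + max_fourier R A ^+ 2 * #|S|%:R :> R.
Proof.
have G0 : 0 < #|G|%:R :> R by rewrite ltr0n; apply/card_gt0P; exists 0.
rewrite -(ler_pM2l G0) mulrDr [_ * (_ / _)]mulrC divfK ?gt_eqF // [X in _ + X]mulrCA.
have overlapC : (\sum_x #|overlap A x|%:R * #|overlap S x|%:R)%:C
    = \sum_x #|overlap A x|%:R * #|overlap S x|%:R :> R[i].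
  by rewrite rmorph_sum; apply: eq_bigr => x _; rewrite rmorphM !rmorph_nat.
rewrite -lecR rmorphD [leLHS]rmorphM /= overlapC.
rewrite [X in _ <= X + _]rmorphM [X in _ <= _ + X]rmorphM /=.
rewrite [X in _ <= _ + _ * X]rmorphM !rmorphXn /= !rmorph_nat.
have := @fourier_energy_bound G R[i] A S (max_fourier R A)%:C.
apply=> [|xi xiD nxi xi1]; first by apply/complex_realP; eexists.
exact: fourier_le_max.
Qed.

End MaxFourier.

(** * Intersections of translates and the bound on [rho] *)

Section Intersections.
Variable G : finZmodType.
Implicit Types A B S X Y : {set G}.

Definition difference A B : {set G} := [set a - b | a in A, b in B]%SET.

Lemma card_differenceC A B : #|difference A B| = #|difference B A|.
Proof.
rewrite -(card_imset _ (@oppr_inj G)); apply: eq_card => x.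
apply/imsetP/imset2P => [[_ /imset2P[a b aA bB ->] ->]|[b a bB aA ->]].
  by exists b a; rewrite ?opprB.
by exists (a - b); rewrite ?opprB //; apply/imset2P; exists a b.
Qed.

Lemma card_difference_ge A B : B != finset.set0 -> (#|A| <= #|difference A B|)%N.
Proof.
case/set0Pn => b bB; rewrite -(card_imset A (addIr (- b))); apply: subset_leq_card.
by apply/fintype.subsetP => _ /imsetP[a aA ->]; apply/imset2P; exists a b.
Qed.

Lemma card_inter_le_rho A l X : #|X| = l ->
  (#|\bigcap_(x in X) translate A x|%SET <= rho l A)%N.
Proof. by move/eqP=> Xl; rewrite /rho; apply: (bigop.bigmax_sup X). Qed.

Lemma mem_translate A x y : (y \in translate A x) = (y - x \in A).
Proof.
apply/imsetP/idP => [[a aA ->]|yxA]; first by rewrite addrK.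
by exists (y - x); rewrite ?subrK.
Qed.

Definition fiber A B (d : G) : {set G} := [set b in B | b + d \in A]%SET.

(** Double counting of the pairs of [d] and an [l]-subset [Y] of [B] with [d + Y] inside [A]: for
    fixed [Y], such [d] lie in all the translates of [A] by elements of [- Y]. *)
Lemma sum_bin_fiber_le A B l :
  (\sum_d 'C(#|fiber A B d|, l) <= rho l A * 'C(#|B|, l))%N.
Proof.
under eq_bigr do rewrite -cards_draws -sum1_card big_mkcond /=.
rewrite exchange_big -cards_draws mulnC -sum_nat_const [leqRHS]big_mkcond /=.
apply: leq_sum => Y _; rewrite inE.
case: ifP => [/andP[YB /eqP Yl]|YB]; last first.
  rewrite big1 // => d _; rewrite inE; case: ifP => // /andP[Yd /eqP Yl].
  move: YB; rewrite Yl eqxx andbT => /negP[]; apply: (fintype.subset_trans Yd).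
  by apply/fintype.subsetP => b; rewrite inE => /andP[].
have oppY : #|[set - y | y in Y]%SET| = l by rewrite card_imset //; apply: oppr_inj.
apply: leq_trans (card_inter_le_rho A oppY).
rewrite -big_mkcond sum1dep_card; apply: subset_leq_card; apply/fintype.subsetP => d.
rewrite !inE => /andP[/fintype.subsetP Yd _].
apply/bigcapP => _ /imsetP[y yY ->]; rewrite mem_translate opprK addrC.
by have := Yd y yY; rewrite inE => /andP[].
Qed.

Lemma sum_card_fiber A B : (\sum_d #|fiber A B d| = #|A| * #|B|)%N.
Proof.
under eq_bigr do rewrite -sum1_card big_mkcond /=.
rewrite exchange_big mulnC -sum_nat_const [RHS]big_mkcond /=.
apply: eq_bigr => b _; have [bB|bB] := ifPn; last first.
  by rewrite big1 // => d _; rewrite inE (negPf bB).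
rewrite -sum1_card [RHS]big_mkcond [RHS](reindex_inj (addrI b)) /=.
by apply: eq_bigr => d _; rewrite inE bB.
Qed.

Lemma fiber_neq0 A B d : (fiber A B d != finset.set0) -> d \in difference A B.
Proof.
case/set0Pn => b; rewrite inE => /andP[bB bdA].
by apply/imset2P; exists (b + d) b => //; rewrite addrC addKr.
Qed.

End Intersections.

(** Each of the [l] factors [r - i] of the falling factorial is at least [r.+1 - l]; for [r < l] the
    truncated base is 0. *)
Lemma expn_le_ffact r l : ((r.+1 - l) ^ l <= r ^_ l)%N.
Proof.
have [rl|lr] := ltnP r l; first by rewrite (_ : r.+1 - l = 0)%N ?exp0n //; lia.
rewrite ffact_prod -[X in (_ ^ X)%N](card_ord l) -prod_nat_const.
by apply: leq_prod => i _; have := ltn_ord i; lia.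
Qed.

(** Convexity of powers: the graph lies above its tangent at [a]. Each induction step leaves a
    surplus of [n.+1%:R * a ^+ n * (y - a) ^+ 2]. *)
Lemma tangent_expr (R : realDomainType) (a y : R) n : 0 <= a -> 0 <= y ->
  a ^+ n.+1 + n.+1%:R * a ^+ n * (y - a) <= y ^+ n.+1.
Proof.
move=> a0 y0; elim: n => [|n IHn]; first by rewrite expr0; lra.
rewrite [leRHS]exprS; apply: le_trans (ler_wpM2l y0 IHn).
rewrite -subr_ge0.
have -> : y * (a ^+ n.+1 + n.+1%:R * a ^+ n * (y - a))
    - (a ^+ n.+2 + n.+2%:R * a ^+ n.+1 * (y - a))
    = n.+1%:R * a ^+ n * (y - a) ^+ 2 by rewrite !exprS -!natr1; ring.
by rewrite mulr_ge0 ?sqr_ge0 // mulr_ge0 ?ler0n ?exprn_ge0.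
Qed.

(** Here [a] is the mean of [r d] over [D]. Falling factorials replace binomials, at the cost of a
    shift by [l]; in the tangent inequality at [a - l] the linear terms sum to zero over [D]. *)
Lemma rho_lower_bound (R : realFieldType) (G : finZmodType) (A B : {set G}) l
    (a := #|A|%:R * #|B|%:R / #|difference A B|%:R : R) :
  (0 < #|difference A B|)%N -> l%:R <= a ->
  #|difference A B|%:R * (a - l%:R) ^+ l.+1
  <= (rho l.+1 A)%:R * #|B|%:R ^+ l.+1.
Proof.
move=> D0 la; set D := difference A B; pose r d := #|fiber A B d|.
have al0 : 0 <= a - l%:R by rewrite subr_ge0.
apply: (@le_trans _ _ (\sum_(d in D) (r d ^_ l.+1)%:R)); last first.
  rewrite -natr_sum -natrX -natrM ler_nat.
  apply: (@leq_trans (\sum_d r d ^_ l.+1)).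
    by rewrite [leqRHS](bigID (mem D)) leq_addr.
  under eq_bigr do rewrite -bin_ffact; rewrite -big_distrl /=.
  apply: leq_trans (leq_mul (sum_bin_fiber_le A B l.+1) (leqnn _)) _.
  rewrite -mulnA leq_mul2l bin_ffact; apply/orP; right.
  rewrite ffact_prod -[X in (_ <= _ ^ X)%N](card_ord l.+1) -prod_nat_const.
  by apply: leq_prod => i _; apply: leq_subr.
have sum_r : \sum_(d in D) (r d)%:R = #|D|%:R * a.
  rewrite /a mulrC divfK ?pnatr_eq0 -?lt0n // -natrM -sum_card_fiber natr_sum.
  rewrite [RHS](bigID (mem D)) /= [X in _ + X]big1 ?addr0 // => d dD.
  by apply/eqP; rewrite pnatr_eq0 cards_eq0; apply: contraNT dD => /fiber_neq0.
apply: (@le_trans _ _ (\sum_(d in D)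
    ((a - l%:R) ^+ l.+1 + l.+1%:R * (a - l%:R) ^+ l * ((r d)%:R - a)))).
  have sumD (c : R) : \sum_(d in D) c = #|D|%:R * c by rewrite sumr_const mulr_natl.
  by rewrite big_split /= -mulr_sumr sumrB sum_r !sumD subrr mulr0 addr0.
apply: ler_sum => d _.
apply: le_trans (_ : (r d - l)%:R ^+ l.+1 <= _); last first.
  by rewrite -natrX ler_nat -subSS; apply: expn_le_ffact.
apply: le_trans (tangent_expr l al0 (ler0n _ _)).
(* The truncated [r d - l] is at least the true difference, and the slope is nonnegative. *)
rewrite lerD2l ler_wpM2l ?mulr_ge0 ?exprn_ge0 ?ler0n //.
rewrite opprB addrA lerBlDr.
have : (r d)%:R <= (r d - l)%:R + l%:R :> R by rewrite -natrD ler_nat; lia.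
lra.
Qed.

(** * Popular differences *)

Section Popular.
Variable G : finZmodType.
Implicit Types A B : {set G}.

(** If [c] and [c + x] lie in [A], then for [a] in [A] both [c - a] and [c - a + x] are differences
    of [A]. *)
Lemma overlap_diffset A x :
  (#|difference A (overlap A x)| <= #|overlap (diffset A) x|)%N.
Proof.
rewrite card_differenceC; apply: subset_leq_card.
apply/fintype.subsetP => _ /imset2P[c a cU aA ->].
move: cU; rewrite inE => /andP[cA cxA].
by rewrite inE; apply/andP; split; apply/imset2P;
   [exists c a | exists (c + x) a => //; rewrite addrAC].
Qed.

Lemma overlap_neq0 A x : (overlap A x != finset.set0) -> x \in diffset A.
Proof.
case/set0Pn => c; rewrite inE => /andP[cA cxA].
by apply/imset2P; exists (c + x) c => //; rewrite addrC addKr.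
Qed.

Lemma sum_card_overlap A : (\sum_x #|overlap A x| = #|A| ^ 2)%N.
Proof. exact: sum_card_fiber. Qed.

(** For [x = a - b], the sets [A - a] and [A - b] lie in [A - A], and adding [b] maps their
    intersection into [overlap A x]; inclusion-exclusion concludes. *)
Lemma card_overlap_ge A x : x \in diffset A ->
  (2 * #|A| <= #|overlap A x| + #|diffset A|)%N.
Proof.
case/imset2P => a b aA bA xE.
have shift c : c \in A -> [set d - c | d in A]%SET \subset diffset A.
  by move=> cA; apply/fintype.subsetP => _ /imsetP[d dA ->]; apply/imset2P; exists d c.
have card_shift c : #|[set d - c | d in A]%SET| = #|A|.
  by rewrite card_imset //; apply: addIr.
rewrite mul2n -addnn -{1}(card_shift a) -(card_shift b) -cardsUI addnC.
apply: leq_add; last by apply: subset_leq_card; rewrite finset.subUset !shift.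
rewrite -(card_imset (mem (overlap A x)) (addIr (- b))); apply: subset_leq_card.
apply/fintype.subsetP => z; rewrite finset.inE => /andP[/imsetP[c cA zc] /imsetP[d dA zd]].
apply/imsetP; exists d => //; rewrite inE dA /=.
suff -> : d + x = c by [].
by rewrite xE addrCA -zd zc addrC subrK.
Qed.

Variable R : realType.

Lemma popular_lower_bound A (t D : R) :
  (forall B, B \subset A -> t <= #|B|%:R -> D <= #|difference A B|%:R) ->
  D * (\sum_(x | t <= #|overlap A x|%:R) #|overlap A x|%:R)
  <= \sum_x #|overlap A x|%:R * #|overlap (diffset A) x|%:R.
Proof.
move=> Dmin; rewrite [leRHS](bigID (fun x => t <= #|overlap A x|%:R)) /=.
rewrite ler_wpDr ?sumr_ge0 // mulr_sumr; apply: ler_sum => x tx.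
rewrite mulrC ler_wpM2l // (le_trans (Dmin (overlap A x) _ tx)) //.
  by apply/fintype.subsetP => c; rewrite inE => /andP[].
by rewrite ler_nat overlap_diffset.
Qed.

(** The unpopular [x] that contribute lie in [A - A], and each contributes less than [t]. *)
Lemma sum_popular_ge A (t : R) : 0 <= t ->
  #|A|%:R ^+ 2 - t * #|diffset A|%:R
  <= \sum_(x | t <= #|overlap A x|%:R) #|overlap A x|%:R.
Proof.
move=> t0; rewrite -natrX -sum_card_overlap natr_sum lerBlDr.
rewrite (bigID (fun x => t <= #|overlap A x|%:R)) /= lerD2l.
rewrite mulr_natr -sumr_const big_mkcond [leRHS]big_mkcond /=.
apply: ler_sum => x _; rewrite -ltNge; case: ltP => [xt|_].
  case: ifPn => [_|xA]; first exact: ltW.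
  rewrite (_ : overlap A x = finset.set0) ?cards0 //.
  by apply/eqP; apply: contraNT xA; apply: overlap_neq0.
by case: ifP.
Qed.

(** By [card_overlap_ge] every difference is popular here, so no mass is lost. This serves for [K]
    close to 1. *)
Lemma sum_popular_small_doubling A (t : R) :
  t <= 2 * #|A|%:R - #|diffset A|%:R ->
  \sum_(x | t <= #|overlap A x|%:R) #|overlap A x|%:R = #|A|%:R ^+ 2 :> R.
Proof.
move=> t_le; rewrite -natrX -sum_card_overlap natr_sum.
rewrite [RHS](bigID (fun x => t <= #|overlap A x|%:R)) /=.
rewrite [X in _ + X]big1 ?addr0 // => x; rewrite -ltNge => xt.
apply/eqP; rewrite pnatr_eq0 cards_eq0; apply: contraTT xt => /overlap_neq0 xA.
rewrite -leNgt (le_trans t_le) // lerBlDr -natrM -natrD ler_nat.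
exact: card_overlap_ge.
Qed.

End Popular.

(** * Numerical estimates and the choice of the minimizing subset *)

Lemma ln_le_half (R : realType) (y : R) : 0 < y -> ln y <= y / 2.
Proof.
move=> y0; have y2 : 0 < y / 2 by rewrite divr_gt0.
have -> : y = 2 * (y / 2) by field.
rewrite lnM ?posrE // [_ * _ / 2](_ : _ = 1 + (y / 2 - 1)); last by field.
have ln2 : ln 2 <= 1 :> R by have := @le_ln1Dx R 1 ltac:(lra).
apply: lerD => //; have := @le_ln1Dx R (y / 2 - 1) ltac:(lra).
by rewrite addrC subrK.
Qed.

Lemma ln_ge_1BV (R : realType) (x : R) : 0 < x -> 1 - x^-1 <= ln x.
Proof.
move=> x0; have x1 : 0 < x^-1 by rewrite invr_gt0.
have := @le_ln1Dx R (x^-1 - 1) ltac:(lra).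
by rewrite addrC subrK lnV ?posrE // => h; lra.
Qed.

Lemma sqr_le_sqrt_sqrt (R : rcfType) (K n : R) : 0 <= K -> K ^+ 8 <= n ->
  K ^+ 2 <= Num.sqrt (Num.sqrt n).
Proof.
move=> K0 Kn; have n0 : 0 <= n by apply: le_trans Kn; apply: exprn_ge0.
rewrite -(@ler_pXn2r _ 4) ?nnegrE ?sqrtr_ge0 ?exprn_ge0 //.
by rewrite -exprM (exprM _ 2 2) !sqr_sqrtr ?sqrtr_ge0.
Qed.

(** With [y] the fourth root of [n], [K ^+ 2 <= y] bounds the left side by [1 / (2 * y)], which is
    at most [1 / ln n] since [ln n = 4 * ln y <= 2 * y]. As [K > 3 / 2], [ln K >= 1 / 3], so that
    [12 * c * ln K ^+ 2 >= 1]. *)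
Lemma doubling_log_loss (R : realType) (K n c : R) :
  3 / 2 < K -> 1 < n -> K ^+ 8 <= n -> 1 <= c ->
  K ^+ 2 / (2 * Num.sqrt n) <= 12 * c * ln K ^+ 2 / ln n.
Proof.
move=> K32 n1 Kn c1; set y := Num.sqrt (Num.sqrt n).
have Ky : K ^+ 2 <= y by apply: sqr_le_sqrt_sqrt => //; lra.
have q0 : 0 < Num.sqrt n by rewrite sqrtr_gt0; lra.
have y0 : 0 < y by rewrite sqrtr_gt0.
have qE : Num.sqrt n = y ^+ 2 by rewrite sqr_sqrtr // ltW.
have nE : n = y ^+ 4 by rewrite (exprM y 2 2) -qE sqr_sqrtr //; lra.
have lnn : ln n <= 2 * y.
  by rewrite nE lnXn // -mulr_natl; have := ln_le_half y0; lra.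
have lnn0 : 0 < ln n by apply: ln_gt0.
have lnK : 1 / 3 <= ln K.
  apply: le_trans (ln_ge_1BV _); last by lra.
  have : K^-1 <= 2 / 3 by rewrite -[leRHS]invrK lef_pV2 ?posrE ?invr_gt0 //; lra.
  lra.
have lnK2 : 1 / 9 <= ln K ^+ 2 by nra.
rewrite qE ler_pdivrMr; last by rewrite mulr_gt0 // exprn_gt0.
rewrite mulrAC ler_pdivlMr //.
have h1 : K ^+ 2 * ln n <= y * (2 * y).
  by apply: ler_pM => //; [apply: exprn_ge0; lra | apply: ltW].
apply: le_trans h1 _.
have h2 : 1 <= 12 * c * ln K ^+ 2 by nra.
have y2 : 0 <= 2 * y ^+ 2 by rewrite mulr_ge0 // exprn_ge0 // ltW.
have -> : y * (2 * y) = 1 * (2 * y ^+ 2) by rewrite expr2; ring.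
exact: ler_wpM2r.
Qed.

Lemma bernoulli_le (R : realDomainType) (x : R) n : x <= 1 ->
  1 - n.+1%:R * x <= (1 - x) ^+ n.+1.
Proof.
move=> x1; have := @tangent_expr R 1 (1 - x) n ler01 _.
rewrite !expr1n mulr1 => /(_ ltac:(lra)); lra.
Qed.

Lemma exists_min_difference (R : realDomainType) (G : finZmodType)
    (A : {set G}) (t : R) : t <= #|A|%:R ->
  exists B : {set G}, [/\ B \subset A, t <= #|B|%:R
    & forall B' : {set G}, B' \subset A -> t <= #|B'|%:R ->
        (#|difference A B| <= #|difference A B'|)%N].
Proof.
move=> tA; pose P (B : {set G}) := (B \subset A) && (t <= #|B|%:R).
have PA : P A by rewrite /P fintype.subxx.
case: (@arg_minnP _ A P (fun B => #|difference A B|) PA) => B /andP[BA tB] Bmin.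
by exists B; split=> // B' B'A tB'; apply: Bmin; rewrite /P B'A.
Qed.

(** * The lower bounds on [max_fourier] and [rho] *)

Section FinalBounds.
Variables (R : realType) (G : finZmodType) (A : {set G}) (K : R).
Local Notation n := (#|A|%:R).
(** This threshold is low enough that unpopular differences carry at most a proportion
    [K ^+ 2 / (2 * Num.sqrt n)] of the mass [n ^+ 2], and high enough that a [B] with [t <= #|B|]
    and at most [K * n] differences has mean fiber at least [Num.sqrt n / 2]. *)
Local Notation t := (K * Num.sqrt n / 2).
Hypothesis (K1 : 1 <= K) (n1 : 1 < n :> R) (K8 : K ^+ 8 <= n).
Hypothesis hK : #|diffset A|%:R = K * n.

Let n0 : 0 < n :> R. Proof. exact: lt_trans ltr01 n1. Qed.
Let q0 : 0 < Num.sqrt n :> R. Proof. by rewrite sqrtr_gt0. Qed.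
Let qE : n = Num.sqrt n ^+ 2 :> R. Proof. by rewrite sqr_sqrtr // ltW. Qed.
Let K0 : 0 < K. Proof. exact: lt_le_trans ltr01 K1. Qed.

Let Kq : K <= Num.sqrt n.
Proof.
rewrite -(@ler_pXn2r _ 2) ?nnegrE ?sqrtr_ge0 ?(ltW K0) //.
by rewrite -qE; apply: le_trans K8; apply: ler_weXn2l.
Qed.

Lemma sum_popular_mass (c : R) : 1 <= c ->
  n ^+ 2 * (1 - 12 * c * ln K ^+ 2 / ln n)
  <= \sum_(x | t <= #|overlap A x|%:R) #|overlap A x|%:R.
Proof.
(* The target loss vanishes at [K = 1], whereas [K ^+ 2 / (2 * Num.sqrt n)] does not, hence the
   split. For [K <= 3 / 2], [t <= n / 2 <= (2 - K) * n] and every difference is popular. *)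
have K0' := K0; have n0' := n0; move=> c1; have [K32|K32] := leP K (3 / 2).
  rewrite sum_popular_small_doubling; last first.
    rewrite hK; have Kqq : K * Num.sqrt n <= n.
      by rewrite [leRHS]qE expr2 ler_wpM2r // ltW.
    have : 0 <= (3 / 2 - K) * n by rewrite mulr_ge0 //; lra.
    by lra.
  rewrite -[leRHS]mulr1 ler_wpM2l ?sqr_ge0 // gerBl.
  apply: divr_ge0; last by rewrite ln_ge0 // ltW.
  by apply: mulr_ge0; [lra | apply: sqr_ge0].
apply: le_trans (sum_popular_ge A _); last by rewrite divr_ge0 // mulr_ge0 // ltW.
have -> : n ^+ 2 - t * #|diffset A|%:R
    = n ^+ 2 * (1 - K ^+ 2 / (2 * Num.sqrt n)).
  by rewrite hK; move: q0 qE; move: (Num.sqrt n) => q q_gt0 ->; field; rewrite gt_eqF.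
by rewrite ler_wpM2l ?sqr_ge0 // lerB // doubling_log_loss.
Qed.

Lemma max_fourier_lower_bound (B : {set G}) (c delta : R) : 1 <= c ->
  n = delta * #|G|%:R -> n <= #|difference A B|%:R :> R ->
  (forall B' : {set G}, B' \subset A -> t <= #|B'|%:R ->
     (#|difference A B| <= #|difference A B'|)%N) ->
  #|difference A B|%:R * n * (1 - 12 * c * ln K ^+ 2 / ln n - K ^+ 2 * delta) / K
  <= max_fourier R A ^+ 2.
Proof.
have K0' := K0; have n0' := n0; move=> c1 hdelta nD Dmin; set D : R := #|difference A B|%:R in nD *.
set eps := 12 * c * ln K ^+ 2 / ln n.
have N0 : 0 < #|G|%:R :> R by rewrite ltr0n; apply/card_gt0P; exists 0.
have deltaE : delta = n / #|G|%:R by rewrite hdelta mulfK ?gt_eqF.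
have S0 : 0 < K * n by rewrite mulr_gt0 //; lra.
have low : D * (n ^+ 2 * (1 - eps))
    <= \sum_x #|overlap A x|%:R * #|overlap (diffset A) x|%:R.
  apply: le_trans (@popular_lower_bound _ R A t D _); last first.
    by move=> B' B'A tB'; rewrite ler_nat Dmin.
  by rewrite ler_wpM2l ?sum_popular_mass // ler0n.
have := le_trans low (sum_overlap_le R A (diffset A)); rewrite hK.
have -> : n ^+ 2 * (K * n) ^+ 2 / #|G|%:R = n ^+ 2 * (K * n) * (K * delta).
  by rewrite deltaE; field; rewrite gt_eqF.
rewrite -lerBlDl => h; rewrite -(ler_pM2r S0); apply: le_trans h.
have d0 : 0 <= delta by rewrite deltaE divr_ge0.
have -> : D * n * (1 - eps - K ^+ 2 * delta) / K * (K * n)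
    = D * (n ^+ 2 * (1 - eps)) - D * (n ^+ 2 * K ^+ 2 * delta) by field; lra.
(* [n <= D] turns a factor [n] of the trivial-character term into [D], so that this term enters the
   bracket as [K ^+ 2 * delta]. *)
rewrite lerB //.
have -> : n ^+ 2 * (K * n) * (K * delta) = n * (n ^+ 2 * K ^+ 2 * delta) by ring.
by apply: ler_wpM2r nD; apply: mulr_ge0 d0; apply: mulr_ge0; apply: sqr_ge0.
Qed.

Lemma rho_lower_bound_sqrt (B : {set G}) l :
  2 * l.+1%:R ^+ 2 < Num.sqrt n :> R -> (0 < #|difference A B|)%N ->
  #|difference A B|%:R <= K * n -> t <= #|B|%:R ->
  n ^+ l.+1 * (1 - 2 * l.+1%:R ^+ 2 / Num.sqrt n)
  <= (rho l.+1 A)%:R * #|difference A B|%:R ^+ l :> R.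
Proof.
have K0' := K0; have n0' := n0; move=> lq D0' DK tB; have D0 : 0 < #|difference A B|%:R :> R by rewrite ltr0n.
pose a := n * #|B|%:R / #|difference A B|%:R : R.
set D : R := #|difference A B|%:R in D0 DK a *; set q : R := Num.sqrt n in lq tB *.
have qa : q / 2 <= a.
  rewrite ler_pdivlMr //; apply: le_trans (_ : q / 2 * (K * n) <= _).
    by rewrite ler_wpM2l // divr_ge0 // ltW.
  have -> : q / 2 * (K * n) = n * (K * q / 2) by field.
  by rewrite ler_wpM2l // ler0n.
have l1 : (l.+1%:R : R) = l%:R + 1 by rewrite -natr1.
have l0 : 0 <= l%:R :> R by rewrite ler0n.
have a0 : 0 < a by nra.
have la : l%:R <= a by nra.
have := @rho_lower_bound R G A B l D0' la; rewrite -/a -/D => rho_low.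
have x_le : l%:R / a <= 1 by rewrite ler_pdivrMr ?mul1r.
(* Bernoulli and [a >= q / 2] bound the loss by [2 * l * (l + 1) / q], which is at most
   [2 * (l + 1) ^+ 2 / q]. *)
apply: (@le_trans _ _ (n ^+ l.+1 * (1 - l%:R / a) ^+ l.+1)).
  rewrite ler_wpM2l ?exprn_ge0 ?ler0n //.
  apply: le_trans (bernoulli_le l x_le); rewrite lerB // mulrA.
  rewrite ler_pdivrMr // mulrAC ler_pdivlMr //; nra.
(* Eliminating [#|B|] in this way cancels the powers of [a] and leaves only [D ^+ l]. *)
have mE : #|B|%:R = a * D / n by rewrite /a; field; apply/andP; split; lra.
have -> : 1 - l%:R / a = (a - l%:R) / a by field; lra.
rewrite exprMn exprVn mulrA ler_pdivrMr ?exprn_gt0 //.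
move: rho_low; rewrite mE -(ler_pM2l (exprn_gt0 l.+1 (lt_trans ltr01 n1))).
rewrite expr_div_n exprMn => h; rewrite -(ler_pM2l D0).
have E1 : D * (n ^+ l.+1 * (a - l%:R) ^+ l.+1) = n ^+ l.+1 * (D * (a - l%:R) ^+ l.+1) by ring.
have E2 : D * ((rho l.+1 A)%:R * D ^+ l * a ^+ l.+1)
  = n ^+ l.+1 * ((rho l.+1 A)%:R * (a ^+ l.+1 * D ^+ l.+1 / n ^+ l.+1)).
  by rewrite (exprS D); field; rewrite expf_neq0 //; lra.
by rewrite E1 E2.
Qed.

End FinalBounds.

(** * Combination of the two bounds *)

Unset Implicit Arguments.
Set Strict Implicit.

(** [hpos] concerns odd [l], where [l.-1] is even: a negative last factor would have a positive
    power, which the argument does not control. For even [l] a negative factor makes the left side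
    nonpositive. *)
Theorem theorem3 (R : realType) (G : finZmodType) (A : {set G}) (l : nat)
    (delta K : R)
    (hl : (1 < l)%N)
    (hdelta : #|A|%:R = delta * #|G|%:R)
    (hK : #|diffset A|%:R = K * #|A|%:R)
    (hAK : K ^+ (8 * l.-1) <= #|A|%:R)
    (hAl : (4 * l ^ 4 < #|A|)%N)
    (hpos : odd l ->
       0 <= 1 - 12 * l.-1%:R * ln K ^+ 2 / ln (#|A|%:R) - K ^+ 2 * delta) :
  #|A|%:R ^+ (2 * l).-1 / K ^+ l.-1
    * (1 - 2 * l%:R ^+ 2 / Num.sqrt (#|A|%:R))
    * (1 - 12 * l.-1%:R * ln K ^+ 2 / ln (#|A|%:R) - K ^+ 2 * delta) ^+ l.-1
  <= max_fourier R A ^+ (2 * l.-1) * (rho l A)%:R.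
Proof.
case: l hl hAK hAl hpos => // k hk; rewrite [k.+1.-1]/= oddS => hAK hAl hpos.
have k0 : (0 < k)%N by [].
have An0 : A != finset.set0 by rewrite -cards_eq0 -lt0n (leq_trans _ hAl).
(* This is the square root of [hAl]; it makes [s] nonnegative and the mean fiber larger than [k]. *)
have lq : 2 * k.+1%:R ^+ 2 < Num.sqrt #|A|%:R :> R.
  rewrite -(@ltr_pXn2r _ 2) ?nnegrE ?sqrtr_ge0 ?mulr_ge0 ?sqr_ge0 //.
  rewrite sqr_sqrtr ?ler0n // exprMn -exprM -!natrX -natrM ltr_nat.
  by apply: leq_ltn_trans hAl; rewrite leq_mul.
have q0 : 0 < Num.sqrt #|A|%:R :> R.
  by apply: le_lt_trans lq; rewrite mulr_ge0 // sqr_ge0.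
have n1 : 1 < #|A|%:R :> R.
  by rewrite ltr1n; apply: leq_trans hAl; rewrite ltnS muln_gt0 expn_gt0.
have n0 : 0 < #|A|%:R :> R by apply: lt_trans n1.
have K1 : 1 <= K.
  by rewrite -(ler_pM2r n0) mul1r -hK ler_nat; apply: card_difference_ge.
have K0 : 0 < K by apply: lt_le_trans K1.
have K8 : K ^+ 8 <= #|A|%:R.
  by apply: le_trans hAK; apply: ler_weXn2l => //; apply: leq_pmulr.
set c := 1 - _ - _ in hpos *; set s := 1 - _ / _.
have s0 : 0 <= s by rewrite subr_ge0 ler_pdivrMr // mul1r ltW.
have M2 : max_fourier R A ^+ (2 * k) = (max_fourier R A ^+ 2) ^+ k by rewrite exprM.
have [c0|c0] := leP 0 c; last first.
  have oddk : odd k by apply: contraTT c0 => /hpos; rewrite -leNgt.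
  apply: (@le_trans _ _ 0).
    rewrite mulr_ge0_le0 //.
      by rewrite mulr_ge0 // divr_ge0 // exprn_ge0 // ltW.
    by rewrite exprn_odd_le0 // ltW.
  by rewrite M2 mulr_ge0 // exprn_ge0 // sqr_ge0.
have tA : K * Num.sqrt #|A|%:R / 2 <= #|A|%:R.
  have Kq : K <= Num.sqrt #|A|%:R.
    rewrite -(@ler_pXn2r _ 2) ?nnegrE ?sqrtr_ge0 ?(ltW K0) //.
    by rewrite sqr_sqrtr ?(ltW n0) //; apply: le_trans K8; apply: ler_weXn2l.
  have := ler_wpM2r (ltW q0) Kq; rewrite -expr2 sqr_sqrtr ?(ltW n0) //; lra.
have [B [BA tB Bmin]] := exists_min_difference tA.
have nD : (#|A| <= #|difference A B|)%N.
  apply: card_difference_ge; rewrite -cards_eq0 -(@pnatr_eq0 R) gt_eqF //.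
  by apply: lt_le_trans tB; rewrite divr_gt0 // mulr_gt0.
have D0 : (0 < #|difference A B|)%N by apply: leq_trans nD; rewrite card_gt0.
(* [A] itself competes in the minimization, by [tA]. *)
have DK : #|difference A B|%:R <= K * #|A|%:R.
  by rewrite -hK ler_nat; apply: Bmin.
have k1 : 1 <= k%:R :> R by rewrite ler1n.
have nDR : #|A|%:R <= #|difference A B|%:R :> R by rewrite ler_nat.
have fourier_low := max_fourier_lower_bound K1 n1 K8 hK k1 hdelta nDR Bmin.
have rho_low := rho_lower_bound_sqrt K1 n1 lq D0 DK tB.
rewrite -/c in fourier_low; rewrite -/s in rho_low.
set D := #|difference A B|%:R in fourier_low rho_low DK nDR.
have x0 : 0 <= D * #|A|%:R * c / K.
  by rewrite divr_ge0 ?(ltW K0) // mulr_ge0 // mulr_ge0 // ler0n.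
rewrite M2; apply: (@le_trans _ _ ((D * #|A|%:R * c / K) ^+ k * (rho k.+1 A)%:R)).
  2: by rewrite ler_wpM2r // lerXn2r ?nnegrE ?sqr_ge0.
have y0 : 0 <= (#|A|%:R * c / K) ^+ k.
  by rewrite exprn_ge0 // divr_ge0 ?(ltW K0) // mulr_ge0 // ltW.
(* One factor is set apart for [rho_low]; the [D ^+ k] produced there is the one contained in the
   Fourier bound. *)
have -> : #|A|%:R ^+ (2 * k.+1).-1 / K ^+ k * s * c ^+ k
    = (#|A|%:R * c / K) ^+ k * (#|A|%:R ^+ k.+1 * s).
  have -> : (2 * k.+1).-1 = (k + k.+1)%N by rewrite mul2n -addnn.
  rewrite exprD expr_div_n exprMn.
  move: (_ ^+ k) (_ ^+ k.+1) (c ^+ k) (K ^+ k)^-1 => a b d e; ring.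
apply: le_trans (ler_wpM2l y0 rho_low) _.
have -> : D * #|A|%:R * c / K = #|A|%:R * c / K * D by ring.
by rewrite [X in _ <= X * _]exprMn [leLHS]mulrA [leRHS]mulrAC.
Qed.
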